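(* Let $L=k(\alpha)$, $\alpha^2=D\in k$, be a quadratic Galois extension of a field $k$ with $\Gamma=\mathrm{Gal}(L/k)=\{1,\sigma\}$, and let $q\in L$ be a primitive root of unity of odd degree $l$. Let $L_q$ be the $L$-algebra generated by $x_1^{\pm1},x_2^{\pm1}$ with relation $x_1x_2=qx_2x_1$, equipped with the action of $\Gamma$ by ring automorphisms, extending the Galois action on $L$, given in one of the following cases: (1) $q\in k$, ${}^\sigma x_1=x_1$, ${}^\sigma x_2=x_2$; (2) ${}^\sigma q=q^{-1}$, ${}^\sigma x_1=x_1$, ${}^\sigma x_2=x_2^{-1}$; (4) ${}^\sigma q=q^{-1}$, ${}^\sigma x_1=x_2$, ${}^\sigma x_2=x_1$. Let $A_Q=L_q^\Gamma$ be the algebra of $\Gamma$-invariants, $Z_Q$ its center, $K$ the field of fractions of $Z_Q$, $\chi:Z_Q\to K$ the natural embedding, and $P_\chi=A_Q\otimes_{Z_Q}K$. Then in each of these cases the skew field $P_\chi$ is a cyclic crossed product over the field $K$.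
   Context: A skew field $P$, finite-dimensional with center $K$, is a cyclic crossed product over $K$ if it contains a maximal subfield that is a Galois extension of $K$ with cyclic Galois group. The algebra $A_Q$ is a quantum form of the two-dimensional $k$-torus whose character module is $\mathbf Z^2$ with $\sigma$ acting by the matrix $\begin{pmatrix}1&0\\0&1\end{pmatrix}$, $\begin{pmatrix}1&0\\0&-1\end{pmatrix}$, $\begin{pmatrix}0&1\\1&0\end{pmatrix}$ in cases (1), (2), (4) respectively. The algebra $P_\chi$ is the specialization of $A_Q$ at the generic point of its center: it is a $K$-form of the cyclic algebra over $K_L=K\otimes_kL$ generated by $x_1,x_2$ with $x_1^l$, $x_2^l$ in $K_L$ and $x_1x_2=qx_2x_1$. *)

(* Defs.v *)
From HB Require Import structures.
From mathcomp Require Import all_boot all_order all_algebra all_fingroup.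
From mathcomp Require Import all_solvable all_field.
From mathcomp Require Import boolp classical_sets.

Set Implicit Arguments.
Unset Strict Implicit.
Unset Printing Implicit Defensive.

Import GRing.Theory.
Local Open Scope ring_scope.

Definition quantum_relations (L : fieldType) (q : L) (B : algType L)
    (y1 y1' y2 y2' : B) : Prop :=
  [/\ y1 * y1' = 1, y1' * y1 = 1, y2 * y2' = 1, y2' * y2 = 1
    & y1 * y2 = q *: (y2 * y1)].

(* T is the L-algebra presented by generators x1^{+-1}, x2^{+-1} and the
   relation x1 x2 = q x2 x1; the presentation is expressed by its universal
   property, which determines (T, x1, x2) up to unique isomorphism. *)
Definition is_quantum_torus (L : fieldType) (q : L) (T : unitAlgType L)
    (x1 x2 : T) : Prop :=
  quantum_relations q x1 x1^-1 x2 x2^-1 /\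
  forall (B : algType L) (y1 y1' y2 y2' : B),
    quantum_relations q y1 y1' y2 y2' ->
    exists f : {lrmorphism T -> B},
      [/\ f x1 = y1, f x2 = y2
        & forall g : {lrmorphism T -> B}, g x1 = y1 -> g x2 = y2 -> g =1 f].

(* An action of Gal(L/k) on an L-algebra T by ring automorphisms that extends
   the Galois action on L.  The product of gal_of {:L} is composition from left
   to right, as in galM; bijectivity of each act g follows from the first two
   conditions. *)
Definition is_semilinear_action (k : fieldType) (L : splittingFieldType k)
    (T : algType L) (act : gal_of {:L} -> {rmorphism T -> T}) : Prop :=
  [/\ forall x, act 1%g x = x,
      forall g h x, act (g * h)%g x = act h (act g x)
    & forall g (a : L), act g a%:A = (g a)%:A].

Section Invariants.
Variables (I : finType) (R : nzRingType) (act : I -> {rmorphism R -> R}).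

Definition ring_invariant : {pred R} := [pred x | [forall g, act g x == x]].

Fact ring_invariant_subring : subring_closed ring_invariant.
Proof.
split=> [|x y|x y]; first by apply/forallP=> g; rewrite rmorph1.
- move=> /forallP xP /forallP yP; apply/forallP=> g.
  by rewrite rmorphB (eqP (xP g)) (eqP (yP g)).
- move=> /forallP xP /forallP yP; apply/forallP=> g.
  by rewrite rmorphM (eqP (xP g)) (eqP (yP g)).
Qed.

HB.instance Definition _ :=
  GRing.isSubringClosed.Build R ring_invariant ring_invariant_subring.

Record invariant_ring : Type := InvariantRing {
  invariant_ring_val : R;
  _ : invariant_ring_val \in ring_invariant
}.

HB.instance Definition _ := [isSub for invariant_ring_val].
HB.instance Definition _ := [Choice of invariant_ring by <:].
HB.instance Definition _ := [SubChoice_isSubNzRing of invariant_ring by <:].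
End Invariants.

Section Center.
Variable R : nzRingType.

Definition ring_central : {pred R} := fun x => `[< forall y, x * y = y * x >].

Fact ring_central_subring : subring_closed ring_central.
Proof.
split=> [|x y|x y]; first by apply/asboolP=> y; rewrite mul1r mulr1.
- move=> /asboolP xP /asboolP yP; apply/asboolP=> z.
  by rewrite mulrBl mulrBr xP yP.
- move=> /asboolP xP /asboolP yP; apply/asboolP=> z.
  by rewrite -mulrA yP mulrA xP mulrA.
Qed.

HB.instance Definition _ :=
  GRing.isSubringClosed.Build R ring_central ring_central_subring.

Record ring_center : Type := RingCenter {
  ring_center_val : R;
  _ : ring_center_val \in ring_central
}.

HB.instance Definition _ := [isSub for ring_center_val].
HB.instance Definition _ := [Choice of ring_center by <:].
HB.instance Definition _ := [SubChoice_isSubNzRing of ring_center by <:].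

Fact ring_center_mulC : commutative (@GRing.mul ring_center).
Proof. by case=> x xP y; apply/val_inj; have /asboolP := xP; apply. Qed.

HB.instance Definition _ :=
  GRing.PzRing_hasCommutativeMul.Build ring_center ring_center_mulC.
End Center.

Definition is_fraction_field (Z : comNzRingType) (K : fieldType)
    (chi : {rmorphism Z -> K}) : Prop :=
  injective chi /\
  forall c : K, exists a b : Z, b != 0 /\ c = chi a / chi b.

Definition balanced (Z A K : pzRingType) (iA : Z -> A) (iK : Z -> K)
    (M : zmodType) (b : A -> K -> M) : Prop :=
  [/\ forall a a' c, b (a + a') c = b a c + b a' c,
      forall a c c', b a (c + c') = b a c + b a c'
    & forall a z c, b (a * iA z) c = b a (iK z * c)].

(* P, with t a c in the role of the pure tensor a (x) c, is the K-algebra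
   A (x)_Z K obtained from a Z-algebra A by extension of scalars along iK: the
   universal balanced map, with the factorwise product and K acting on the
   second factor. *)
Definition is_scalar_extension (Z : comNzRingType) (A : nzRingType)
    (K : fieldType) (iA : Z -> A) (iK : Z -> K) (P : algType K)
    (t : A -> K -> P) : Prop :=
  [/\ balanced iA iK t,
      forall (M : zmodType) (b : A -> K -> M), balanced iA iK b ->
        exists f : {additive P -> M},
          (forall a c, f (t a c) = b a c) /\
          forall g : {additive P -> M},
            (forall a c, g (t a c) = b a c) -> g =1 f,
      t 1 1 = 1,
      forall a a' c c', t a c * t a' c' = t (a * a') (c * c')
    & forall a c c', c *: t a c' = t a (c * c')].

Definition is_skew_field (P : nzRingType) : Prop :=
  forall x : P, x != 0 -> exists y, x * y = 1 /\ y * x = 1.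

Definition finite_dimensional (K : fieldType) (P : lmodType K) : Prop :=
  exists (n : nat) (v : 'I_n -> P),
    forall x, exists c : 'I_n -> K, x = \sum_i c i *: v i.

Definition has_center (K : fieldType) (P : algType K) : Prop :=
  forall x : P, x \in @ring_central P <-> exists c : K, x = c%:A.

Definition is_subfield (P : nzRingType) (F : set P) : Prop :=
  [/\ F 1,
      forall x y, F x -> F y -> F (x - y),
      forall x y, F x -> F y -> F (x * y),
      forall x y, F x -> F y -> x * y = y * x
    & forall x, F x -> x != 0 -> exists2 y, F y & x * y = 1].

Definition is_maximal_subfield (P : nzRingType) (F : set P) : Prop :=
  is_subfield F /\ forall F' : set P, is_subfield F' -> (F `<=` F')%classic ->
    F' = F.

(* The subfield that is cyclic Galois over K is the image of an abstract
   extension E of K under a K-algebra embedding. *)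
Definition is_cyclic_crossed_product (K : fieldType) (P : algType K) : Prop :=
  [/\ is_skew_field P, finite_dimensional P, has_center P
    & exists (E : splittingFieldType K) (f : {lrmorphism E -> P}),
        [/\ is_maximal_subfield (range f), galois 1 {:E}
          & cyclic 'Gal({:E} / 1)]].

(* Main.v *)
(* Write T for the quantum torus, A for its invariants and C(w) for the
   centralizer of w.  In each case T contains units y, z, with z = x2 in cases
   (1), (2) and z = x1 x2^-1 in case (4), such that y is invariant, y z = zeta z y
   for a primitive l-th root of unity zeta, and only central elements commute with
   both y and z.  The invariant element w = z (case (1)) or w = z + z^-1 (cases
   (2), (4), where sigma inverts z) has C(w) = C(z), which is commutative and
   stable under conjugation by y.  In P_chi the centralizer of w is therefore a
   maximal subfield, conjugation by y is an automorphism of finite order of it,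
   and the fixed field is the center K; by Artin's theorem it is cyclic over K.

   That P_chi is a finite-dimensional skew field with center K follows from T
   being a domain (leading coefficients in x2) and from an explicit dual basis of
   A over its center, obtained by Fourier inversion from the sum of the
   conjugates under all y^i z^j. *)
Require Import Defs.
From HB Require Import structures.
From mathcomp Require Import all_boot all_order all_algebra all_fingroup.
From mathcomp Require Import all_solvable all_field.
From mathcomp Require Import zify boolp.
From mathcomp Require classical_sets.

Set Implicit Arguments.
Unset Strict Implicit.
Unset Printing Implicit Defensive.

Import GRing.Theory.
Local Open Scope ring_scope.

(** * Subalgebras and finite dimension *)

Section SubAlgebra.
Variables (F : fieldType) (B : algType F) (S : subalgClosed B).

(** Packaging a closed predicate as an algebra in its own right lets universal properties and field
    structures be applied to it. *)
Record sub_algebra : Type := SubAlgebra {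
  sub_algebra_val : B;
  _ : sub_algebra_val \in S
}.

HB.instance Definition _ := [isSub for sub_algebra_val].
HB.instance Definition _ := [Choice of sub_algebra by <:].
HB.instance Definition _ := [SubChoice_isSubAlgebra of sub_algebra by <:].

HB.instance Definition _ := GRing.isZmodMorphism.Build sub_algebra B
  sub_algebra_val (fun x y => raddfB \val x y).
HB.instance Definition _ := GRing.isMonoidMorphism.Build sub_algebra B
  sub_algebra_val (rmorph1 \val, fun x y => rmorphM \val x y).
HB.instance Definition _ := GRing.isScalable.Build F sub_algebra B _
  sub_algebra_val (fun=> fun=> erefl).
End SubAlgebra.

Section FiniteDimension.
Variable K : fieldType.

Definition lin_free (V : lmodType K) m (u : 'I_m -> V) : Prop :=
  forall c : 'I_m -> K, \sum_i c i *: u i = 0 -> forall i, c i = 0.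

(** If there were more vectors than generators, the coefficient matrix would have a nonzero left
    kernel, and a row of it is a linear relation. *)
Lemma finite_dimensional_dependent (V : lmodType K) n (v : 'I_n -> V) m
    (u : 'I_m -> V) :
  (forall x, exists c : 'I_n -> K, x = \sum_i c i *: v i) ->
  lin_free u -> (m <= n)%N.
Proof.
move=> span free_u; rewrite leqNgt; apply/negP=> lt_nm.
have [M uE] : exists M : 'M[K]_(m, n), forall i, u i = \sum_j M i j *: v j.
  have [f fE] := choice (fun i => span (u i)).
  exists (\matrix_(i, j) f i j) => i; rewrite {1}fE.
  by apply: eq_bigr => j _; rewrite mxE.
have /rowV0Pn[c /sub_kermxP cM /negP[]] : kermx M != 0.
  rewrite -mxrank_eq0 mxrank_ker -lt0n subn_gt0.
  exact: leq_ltn_trans (rank_leq_col M) lt_nm.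
apply/eqP/rowP=> i; rewrite mxE; apply: (free_u (c 0)).
under eq_bigr do rewrite uE scaler_sumr.
rewrite exchange_big big1 //= => j _.
transitivity ((c *m M) 0 j *: v j); last by rewrite cM mxE scale0r.
by rewrite mxE scaler_suml; apply: eq_bigr => k _; rewrite scalerA.
Qed.

(** A free family of maximal length is a basis; uniqueness of coordinates makes the coordinate map
    linear. *)
Lemma lin_free_bounded_vector (V : lmodType K) n :
    (forall m (u : 'I_m -> V), lin_free u -> (m <= n)%N) ->
  exists d, inhabited (Vector.axiom d V).
Proof.
move=> bound; pose Q m := `[< exists u : 'I_m -> V, lin_free u >].
have Q0 : exists m, Q m.
  exists 0%N; apply/asboolP; exists (fun=> 0) => c _ i.
  by have := ltn_ord i; rewrite ltn0.
have Qle m : Q m -> (m <= n)%N by move=> /asboolP[u]; apply: bound.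
case: (ex_maxnP Q0 Qle) => d /asboolP[u free_u] dmax.
have coordP x : exists c : 'I_d -> K, x = \sum_i c i *: u i.
  (* Appending [x] in last position breaks freeness by maximality; the coefficient of [x] in the
     relation is nonzero because [u] is free. *)
  pose u' (i : 'I_d.+1) := if unlift ord_max i is Some j then u j else x.
  have /existsNP[c /not_implyP[c0 /existsNP[i ci]]] : ~ lin_free u'.
    move=> free_u'; have : Q d.+1 by apply/asboolP; exists u'.
    by move/dmax; rewrite ltnn.
  have eq0 : \sum_j c (lift ord_max j) *: u j + c ord_max *: x = 0.
    rewrite -[RHS]c0 big_ord_recr /= /u' unlift_none; congr (_ + _).
    apply: eq_bigr => j _.
    have -> : widen_ord (leqnSn d) j = lift ord_max j.
      by apply/val_inj; rewrite /= /bump leqNgt ltn_ord.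
    by rewrite liftK.
  have cx : c ord_max != 0.
    apply/eqP=> cx; case: ci; rewrite cx scale0r addr0 in eq0.
    by case: (unliftP ord_max i) => [j|] ->; [apply: free_u eq0 j | exact: cx].
  exists (fun j => - (c ord_max)^-1 * c (lift ord_max j)).
  under eq_bigr do rewrite -scalerA; rewrite -scaler_sumr.
  rewrite -[X in _ = _ *: X](addrK (c ord_max *: x)) eq0 sub0r.
  by rewrite scalerN scaleNr opprK scalerA mulVf // scale1r.
have [co coE] := choice coordP.
have coP x (c : 'rV_d) : x = \sum_i c 0 i *: u i -> \row_i co x i = c.
  move=> xE; apply/rowP=> i; rewrite mxE; apply/eqP; rewrite -subr_eq0.
  apply/eqP; apply: (free_u (fun i => co x i - c 0 i)).
  under eq_bigr do rewrite scalerBl.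
  by rewrite sumrB -coE -xE subrr.
exists d; constructor; exists (fun x => \row_i co x i).
  move=> a x y; apply: coP; rewrite {1}[x]coE {1}[y]coE scaler_sumr -big_split.
  by apply: eq_bigr => i _; rewrite !mxE scalerDl scalerA.
exists (fun c : 'rV_d => \sum_i c 0 i *: u i) => [x|c]; last exact: coP.
by rewrite [RHS]coE; apply: eq_bigr => i _; rewrite mxE.
Qed.

Lemma skew_field_of_domain (P : algType K) :
  finite_dimensional P -> (forall x y : P, x * y = 0 -> x = 0 \/ y = 0) ->
  is_skew_field P.
Proof.
move=> [n [v span]] domP x x0.
have xn0 i : x ^+ i <> 0.
  elim: i => [|i IHi]; first by rewrite expr0; apply/eqP; rewrite oner_neq0.
  by rewrite exprS => /domP[x00|/IHi //]; rewrite x00 eqxx in x0.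
have /existsNP[c /not_implyP[c0 /existsNP[i ci]]] :
    ~ lin_free (fun i : 'I_n.+1 => x ^+ i).
  by move/(finite_dimensional_dependent span); rewrite ltnn.
(* A polynomial vanishing at x, stripped of its power of X, has a nonzero constant
   term, from which the inverse of x is read off. *)
pose p := \poly_(i < n.+1) c (inord i).
have pE : horner_alg x p = 0.
  rewrite /p poly_def linear_sum -[RHS]c0; apply: eq_bigr => j _ /=.
  by rewrite linearZ rmorphXn /= horner_algX inord_val mulr_algl.
have p0 : p != 0.
  apply/eqP=> /(congr1 (coefp i)); rewrite /= coef_poly ltn_ord inord_val.
  by rewrite coef0 => /ci.
have [m [r r0 pr]] := multiplicity_XsubC p 0.
rewrite p0 /= in r0; rewrite {}pr rmorphM rmorphXn /= subr0 horner_algX in pE.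
have {pE} rx : horner_alg x r = 0 by case/domP: pE => // /xn0.
have r00 : r.[0] != 0 by rewrite -rootE.
have [s sE] : exists s, s * 'X = 1 - (r.[0])^-1 *: r.
  exists ((1 - (r.[0])^-1 *: r) %/ 'X); apply: divpK.
  rewrite -['X]subr0 -[X in _ - X]/(0%:P) dvdp_XsubCl rootE.
  by rewrite !hornerE mulVf ?subrr.
have sx : horner_alg x (1 - (r.[0])^-1 *: r) = 1.
  by rewrite rmorphB rmorph1 /= linearZ /= rx mulr0 subr0.
exists (horner_alg x s); split.
  by rewrite -{1}[x](horner_algX x) -rmorphM /= mulrC sE.
by rewrite -{2}[x](horner_algX x) -rmorphM /= sE.
Qed.
End FiniteDimension.

(** [E] is the subalgebra itself: inverses taken in [P] stay in [S], and a family free in [S] is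
    free in [P], which bounds the dimension. *)
Lemma commutative_subalgebra_fieldExt (K : fieldType) (P : algType K)
    (S : subalgClosed P) :
  is_skew_field P -> finite_dimensional P -> {in S &, commutative *%R} ->
  (forall x y, x \in S -> x * y = 1 -> y \in S) ->
  exists (E : fieldExtType K) (f : {lrmorphism E -> P}),
    forall x, x \in S <-> exists e, f e = x.
Proof.
move=> skewP [n [v span]] commS invS.
pose E0 := sub_algebra S.
have mulEC : commutative (@GRing.mul E0).
  by move=> x y; apply/val_inj; apply: commS; apply: valP.
pose E1 : comNzRingType := HB.pack E0
  (GRing.PzRing_hasCommutativeMul.Build E0 mulEC).
have invP (x : E0) : exists y : E0, (x != 0 -> y * x = 1) /\ (x = 0 -> y = 0).
  have [->|x0] := eqVneq x 0; first by exists 0.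
  have /skewP[y [xy yx]] : val x != 0.
    by apply: contra x0 => /eqP x0; apply/eqP/val_inj; rewrite x0 raddf0.
  exists (Sub y (invS _ _ (valP x) xy)); split=> [_|x00].
    by apply/val_inj; rewrite rmorphM.
  by rewrite x00 eqxx in x0.
have [inv invE] := choice invP.
have mulVf (x : E1) : x != 0 -> inv x * x = 1 by case: (invE x) => h _ /h.
have invr0 : inv (0 : E1) = 0 by case: (invE 0) => _ ->.
pose E2 : fieldType := HB.pack E1
  (GRing.ComNzRing_isField.Build E1 mulVf invr0).
have [d [vecE]] : exists d, inhabited (Vector.axiom d (E0 : lmodType K)).
  apply: (@lin_free_bounded_vector _ _ n) => m u free_u.
  apply: (finite_dimensional_dependent (u := fun i => val (u i)) span) => c c0.
  apply: free_u; apply/val_inj; rewrite raddf0 -[RHS]c0 raddf_sum.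
  exact: eq_bigr.
pose E : fieldExtType K := HB.pack E0 E2 (Lmodule_hasFinDim.Build K E0 vecE).
pose f : {lrmorphism sub_algebra S -> P} := @sub_algebra_val _ _ S.
exists E, f => x; split=> [xS|[e <-]]; last exact: valP.
by exists (Sub x xS).
Qed.

(** * Cyclic maximal subfields *)

Section CyclicFixedField.
Variables (K : fieldType) (n : nat).

Lemma finite_order_splitting (E : fieldExtType K) (tau : {lrmorphism E -> E}) :
    (forall x, iter n.+1 tau x = x) -> (forall x, tau x = x -> x \in 1%VS) ->
  splitting_field_axiom E.
Proof.
move=> tau_n fix_tau; apply: normal_field_splitting => M x.
(* Artin: the minimal polynomial of x divides the product over its tau-orbit. *)
pose p := \prod_(j < n.+1) ('X - (iter j tau x)%:P).
have p1 : p \is a polyOver 1%VS.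
  (* Applying [tau] shifts the orbit by one place, and the last factor becomes the first since
     [iter n.+1 tau] is the identity. *)
  have tau_p : map_poly tau p = p.
    rewrite rmorph_prod big_ord_recr [RHS]big_ord_recl [RHS]mulrC /=.
    congr (_ * _); last by rewrite -[in RHS](tau_n x) map_polyXsubC.
    by apply: eq_bigr => j _; rewrite /= map_polyXsubC.
  by apply/polyOverP=> i; apply: fix_tau; rewrite -coef_map tau_p.
have px : root p x.
  by rewrite /p big_ord_recl rootM root_XsubC eqxx.
have := minPoly_dvdp (polyOverSv (sub1v M) p1) px.
rewrite /p -(big_map _ xpredT (fun y => 'X - y%:P)).
set r := map _ _ => /dvdp_prod_XsubC[m eq_m]; exists (mask m r).
by rewrite -eqp_monic ?monic_minPoly ?monic_prod_XsubC.
Qed.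

(** The cyclic group generated by [tau] has fixed field K, so by the Galois correspondence it is the
    whole Galois group. *)
Lemma finite_order_cyclic_galois (E : splittingFieldType K)
    (tau : {lrmorphism E -> E}) :
    (forall x, tau x = x -> x \in 1%VS) ->
  galois 1 {:E} /\ cyclic 'Gal({:E} / 1).
Proof.
move=> fix_tau; pose g := gal {:E} (linfun_ahom tau).
have gE x : g x = tau x by rewrite galK ?subvf ?memvf // lfunE.
have fixE : fixedField <[g]>%g = 1%VS.
  apply/eqP; rewrite eqEsubv sub1v andbT; apply/subvP=> x.
  case/mem_fixedFieldP=> _ fix_x.
  by apply: fix_tau; rewrite -gE fix_x ?cycle_id.
rewrite -fixE; split; first exact: fixedField_galois.
by rewrite gal_fixedField cycle_cyclic.
Qed.
End CyclicFixedField.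

Section Centralizer.
Variables (F : fieldType) (B : algType F) (w : B).

Definition centralizer : {pred B} := fun x => `[< x * w = w * x >].

Fact centralizer_subalg : subalg_closed centralizer.
Proof.
split=> [|a x y|x y]; first by apply/asboolP; rewrite mul1r mulr1.
- move=> /asboolP xw /asboolP yw; apply/asboolP.
  by rewrite mulrDl mulrDr -scalerAl -scalerAr xw yw.
- move=> /asboolP xw /asboolP yw; apply/asboolP.
  by rewrite -mulrA yw mulrA xw mulrA.
Qed.

HB.instance Definition _ :=
  GRing.isSubalgClosed.Build F B centralizer centralizer_subalg.
End Centralizer.

(** C(w) is a field. A subfield containing it contains [w] and is commutative, hence lies in C(w),
    which gives maximality. Conjugation by [y'] restricts to C(w), has finite order because
    [y ^+ n.+1] is central, and fixes only elements of the center. *)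
Lemma cyclic_crossed_product_criterion (K : fieldType) (P : algType K)
    (w y y' : P) (n : nat) :
  is_skew_field P -> finite_dimensional P -> has_center P ->
  y * y' = 1 -> y' * y = 1 -> (forall x, x * y ^+ n.+1 = y ^+ n.+1 * x) ->
  y * w * y' \in centralizer w ->
  {in centralizer w &, commutative *%R} ->
  (forall x, x \in centralizer w -> x * y = y * x -> x \in @ring_central P) ->
  is_cyclic_crossed_product P.
Proof.
move=> skewP finP centP yy' y'y ycent w1C commC fixC.
have invC x z : x \in centralizer w -> x * z = 1 -> z \in centralizer w.
  move=> /asboolP xw xz; apply/asboolP.
  have /skewP[z' [xz' z'x]] : x != 0.
    by apply: contra_eq_neq xz => ->; rewrite mul0r eq_sym oner_neq0.
  have {xz} <- : z' = z by rewrite -[LHS]mulr1 -xz mulrA z'x mul1r.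
  by rewrite -[z' * w]mulr1 -xz' -!mulrA (mulrA w) -xw !mulrA z'x mul1r.
have [E [f fE]] := commutative_subalgebra_fieldExt skewP finP commC invC.
have fC e : f e \in centralizer w by apply/fE; exists e.
have injf : injective f := fmorph_inj f.
(* f e commutes with y w y', as both lie in the commutative C(w); conjugating by y,
   y' (f e) y commutes with w. *)
have /choice[tau tauE] : forall e, exists e', f e' = y' * f e * y.
  move=> e; apply/fE/asboolP.
  have := commC _ _ w1C (fC e); rewrite -!mulrA => /(congr1 (fun z => y' * (z * y))).
  by rewrite -!mulrA y'y mulr1 !mulrA y'y mul1r => <-.
have tauB : zmod_morphism tau.
  by move=> a b; apply: injf; rewrite rmorphB /= !tauE rmorphB mulrBr mulrBl.
have tauM : monoid_morphism tau.
  split=> [|a b]; apply: injf; first by rewrite tauE !rmorph1 mulr1.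
  rewrite rmorphM /= !tauE rmorphM /= -!mulrA; congr (_ * (_ * _)).
  by rewrite !mulrA yy' mul1r.
have tauZ : scalable tau.
  by move=> a b; apply: injf; rewrite linearZ /= !tauE linearZ /= -scalerAr -scalerAl.
pose tauR : {lrmorphism E -> E} := HB.pack tau
  (GRing.isZmodMorphism.Build E E tau tauB)
  (GRing.isMonoidMorphism.Build E E tau tauM)
  (GRing.isScalable.Build K E E _ tau tauZ).
have fix_tau x : tau x = x -> x \in 1%VS.
  move=> fix_x; have /fixC : f x \in centralizer w by [].
  case/(_ _)/centP=> [|c fxE].
    by rewrite -{2}fix_x tauE !mulrA yy' mul1r.
  have -> : x = c%:A by apply: injf; rewrite fxE linearZ /= rmorph1.
  by rewrite memvZ ?mem1v.
have iter_tau m e : f (iter m tau e) = y' ^+ m * f e * y ^+ m.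
  elim: m => [|m IHm] /=; first by rewrite mulr1 mul1r.
  by rewrite tauE IHm exprS exprSr !mulrA.
have tau_n e : iter n.+1 tau e = e.
  apply: injf; rewrite iter_tau -mulrA ycent mulrA -exprMn_comm.
    by rewrite y'y expr1n mul1r.
  by rewrite /GRing.comm y'y yy'.
have splitE := @finite_order_splitting K n E tauR tau_n fix_tau.
pose E' : splittingFieldType K := HB.pack (E : Type) E
  (FieldExt_isSplittingField.Build K E splitE).
have [galE cycE] := @finite_order_cyclic_galois K E' tauR fix_tau.
split=> //; exists E', f; split=> //.
have fieldf : is_subfield (classical_sets.range f).
  split=> [|_ _ [a _ <-] [b _ <-]|_ _ [a _ <-] [b _ <-]|_ _ [a _ <-] [b _ <-]|].
  - by exists 1; rewrite ?rmorph1.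
  - by exists (a - b); rewrite ?rmorphB.
  - by exists (a * b); rewrite ?rmorphM.
  - by rewrite -!rmorphM mulrC.
  - move=> _ [a _ <-]; rewrite fmorph_eq0 => a0; exists (f a^-1).
      by exists a^-1.
    by rewrite -rmorphM mulfV ?rmorph1.
split=> // F' [_ _ _ commF' _] sub; apply/classical_sets.seteqP; split=> // x F'x.
have wC : w \in centralizer w by apply/asboolP.
have /fE[e <-] : x \in centralizer w.
  apply/asboolP/commF' => //; apply: sub.
  by case/fE: wC => e <-; exists e.
by exists e.
Qed.

(** * The quantum torus is a domain *)

Section MonomialMatrix.
Variables (R : fieldType) (n : nat).
Implicit Types (f g : 'I_n.+1 -> 'I_n.+1) (c d : 'I_n.+1 -> R).

(** On row vectors, basis vector [a] goes to [c a] times basis vector [f a]; this is why products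
    compose as [g \o f]. *)
Definition monomial_mx f c : 'M[R]_n.+1 :=
  \matrix_(a, b) (c a * (b == f a)%:R).

Lemma eq_monomial_mx f g c d :
  f =1 g -> c =1 d -> monomial_mx f c = monomial_mx g d.
Proof. by move=> fg cd; apply/matrixP=> a b; rewrite !mxE fg cd. Qed.

Lemma mul_monomial_mx f g c d :
  monomial_mx f c * monomial_mx g d
    = monomial_mx (g \o f) (fun a => c a * d (f a)).
Proof.
apply/matrixP=> a b; rewrite !mxE (bigD1 (f a)) //= big1 => [|e /negPf e_fa].
  by rewrite !mxE eqxx mulr1 addr0 mulrA.
by rewrite !mxE e_fa mulr0 mul0r.
Qed.

Lemma monomial_mx_unit f c : injective f -> (forall a, c a != 0) ->
  exists B, monomial_mx f c * B = 1 /\ B * monomial_mx f c = 1.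
Proof.
move=> f_inj c0; exists (monomial_mx (invF f_inj) (fun a => (c (invF f_inj a))^-1)).
suff E : monomial_mx f c * monomial_mx (invF f_inj) (fun a => (c (invF f_inj a))^-1) = 1.
  by split=> //; apply: mulmx1C.
rewrite mul_monomial_mx; apply/matrixP=> a b.
by rewrite !mxE /= invF_f mulfV // mul1r eq_sym.
Qed.
End MonomialMatrix.

Section QuantumTorus.
Variables (L : fieldType) (q : L) (T : unitAlgType L) (x1 x2 : T).
Hypothesis torus : is_quantum_torus q x1 x2.

Lemma quantum_torus_ind (Q : T -> Prop) :
  Q 1 -> (forall a s t, Q s -> Q t -> Q (a *: s + t)) ->
  (forall s t, Q s -> Q t -> Q (s * t)) ->
  Q x1 -> Q x1^-1 -> Q x2 -> Q x2^-1 -> forall t, Q t.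
Proof.
move=> Q1 QZ QM Qx1 Qx1V Qx2 Qx2V.
(* The map from T to the subalgebra S = {t | Q t} given by the universal property,
   followed by the inclusion, fixes x1 and x2, so it is the identity of T. *)
pose S0 : {pred T} := fun t => `[< Q t >].
have S0_alg : subalg_closed S0.
  split=> [|a s t /asboolP Qs /asboolP Qt|s t /asboolP Qs /asboolP Qt].
  - exact/asboolP.
  - exact/asboolP/QZ.
  - exact/asboolP/QM.
pose S : subalgClosed T := HB.pack S0 (GRing.isSubalgClosed.Build L T S0 S0_alg).
have [[x1V x1V' x2V x2V' x12] univ] := torus.
pose sub t (Qt : Q t) : sub_algebra S := @SubAlgebra _ _ S t (asboolT Qt).
have [f [fx1 fx2 _]] : exists f : {lrmorphism T -> sub_algebra S},
    [/\ f x1 = sub _ Qx1, f x2 = sub _ Qx2 & forall g : {lrmorphism T -> sub_algebra S},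
        g x1 = sub _ Qx1 -> g x2 = sub _ Qx2 -> g =1 f].
  apply: (univ _ _ (sub _ Qx1V) _ (sub _ Qx2V)).
  by split; apply/val_inj.
have [h [_ _ h_uniq]] := univ _ _ _ _ _ torus.1.
pose g : {lrmorphism T -> T} := @sub_algebra_val _ _ S \o f.
move=> t; have -> : t = g t.
  rewrite (h_uniq g) /= ?fx1 ?fx2 //.
  exact: (h_uniq (idfun : {lrmorphism T -> T})).
exact/asboolP/(valP (f t)).
Qed.
End QuantumTorus.

Lemma primitive_root_neq0 (L : fieldType) l (w : L) :
  l.-primitive_root w -> w != 0.
Proof.
move=> w_prim; have := oner_neq0 L; rewrite -(prim_expr_order w_prim) expf_eq0.
by rewrite (prim_order_gt0 w_prim).
Qed.

Section QuantumTorusDomain.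
Variables (L : fieldType) (q : L) (l : nat) (T : unitAlgType L) (x1 x2 : T).
Hypotheses (torus : is_quantum_torus q x1 x2) (q_prim : l.-primitive_root q).

Let q0 : q != 0 := primitive_root_neq0 q_prim.

Let x12 : x1 * x2 = q *: (x2 * x1).
Proof. by case: torus => [[]]. Qed.

Let x21 : x2 * x1 = q^-1 *: (x1 * x2).
Proof. by rewrite x12 scalerA mulVf ?scale1r. Qed.

(* The inner variable stands for x1, the outer one for x2, with the powers of x1
   written on the left. *)
Definition torus_eval (p : {poly {poly L}}) : T :=
  (map_poly (horner_alg x1) p).[x2].

Lemma torus_evalD p r : torus_eval (p + r) = torus_eval p + torus_eval r.
Proof. by rewrite /torus_eval rmorphD hornerD. Qed.

Lemma torus_evalZ c p : torus_eval (c *: p) = horner_alg x1 c * torus_eval p.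
Proof. by rewrite /torus_eval map_polyZ hornerZ. Qed.

Lemma torus_evalMXn p i : torus_eval (p * 'X^i) = torus_eval p * x2 ^+ i.
Proof.
elim: i => [|i IHi]; first by rewrite !mulr1.
rewrite exprSr mulrA exprSr mulrA -IHi /torus_eval rmorphM /= map_polyX.
by rewrite hornerMX.
Qed.

Lemma torus_evalC c : torus_eval c%:P = horner_alg x1 c.
Proof. by rewrite /torus_eval map_polyC hornerC. Qed.

Lemma torus_eval0 : torus_eval 0 = 0.
Proof. by rewrite -polyC0 torus_evalC rmorph0. Qed.

Lemma torus_eval1 : torus_eval 1 = 1.
Proof. by rewrite torus_evalC rmorph1. Qed.

Lemma torus_eval_x1 : torus_eval 'X%:P = x1.
Proof. by rewrite torus_evalC horner_algX. Qed.

Lemma torus_eval_x2 : torus_eval 'X = x2.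
Proof.
by have := torus_evalMXn 1 1; rewrite mul1r torus_eval1 mul1r !expr1.
Qed.

Lemma horner_algE n (c : {poly L}) : (size c <= n)%N ->
  horner_alg x1 c = \sum_(i < n) c`_i *: x1 ^+ i.
Proof.
move=> size_c; rewrite [LHS](@horner_coef_wide _ n).
  by apply: eq_bigr => i _; rewrite coef_map /= mulr_algl.
exact: leq_trans (size_poly _ _) size_c.
Qed.

Lemma torus_evalE_outer n (p : {poly {poly L}}) : (size p <= n)%N ->
  torus_eval p = \sum_(j < n) horner_alg x1 p`_j * x2 ^+ j.
Proof.
move=> size_p; rewrite /torus_eval (@horner_coef_wide _ n).
  by apply: eq_bigr => j _; rewrite coef_map.
exact: leq_trans (size_poly _ _) size_p.
Qed.

Lemma torus_evalE n (p : {poly {poly L}}) :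
  (size p <= n)%N -> (forall j, (size (p`_j)%R <= n)%N) ->
  torus_eval p = \sum_(j < n) \sum_(i < n) p`_j`_i *: (x1 ^+ i * x2 ^+ j).
Proof.
move=> size_p size_pj; rewrite (torus_evalE_outer size_p).
apply: eq_bigr => j _; rewrite (horner_algE (size_pj j)) mulr_suml.
by apply: eq_bigr => i _; rewrite scalerAl.
Qed.

Lemma size_bound (p : {poly {poly L}}) :
  exists n, (size p <= n)%N /\ (forall j, size (p`_j)%R <= n)%N.
Proof.
exists (size p + \max_(j < size p) size (p`_j)%R)%N; split=> [|j].
  exact: leq_addr.
have [/(nth_default 0)-> |lt_j] := leqP (size p) j; first by rewrite size_poly0.
apply: leq_trans (leq_addl _ _).
exact: (@leq_bigmax _ (fun j : 'I_(size p) => size p`_j) (Ordinal lt_j)).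
Qed.

Lemma torus_eval_twist s lam c : s * x1 = lam *: (x1 * s) ->
  s * horner_alg x1 c = horner_alg x1 (c \Po (lam *: 'X)) * s.
Proof.
move=> sx1; elim/poly_ind: c => [|c k IHc].
  by rewrite comp_poly0 !rmorph0 mulr0 mul0r.
rewrite comp_polyD comp_polyM comp_polyX comp_polyC !rmorphD !rmorphM /=.
rewrite linearZ /= !horner_algX !horner_algC.
rewrite mulrDr mulrDl; congr (_ + _); last by rewrite mulr_algl mulr_algr.
by rewrite (mulrA s) [s * _]IHc -!mulrA sx1 mulr_algl.
Qed.

Lemma x2_expr_x1 i : x2 ^+ i * x1 = q ^- i *: (x1 * x2 ^+ i).
Proof.
elim: i => [|i IHi]; first by rewrite invr1 scale1r mulr1 mul1r.
rewrite {1}exprSr -mulrA x21 -scalerAr (mulrA (x2 ^+ i)) IHi -scalerAl scalerA.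
by rewrite -mulrA -exprSr -invfM -exprS.
Qed.

(** The product of a skew polynomial ring: moving [x2 ^+ i] to the right of a polynomial in [x1]
    rescales [x1] by [q ^- i]. *)
Definition torus_mul (p r : {poly {poly L}}) : {poly {poly L}} :=
  \sum_(i < size p) p`_i *: (map_poly (comp_poly (q ^- i *: 'X)) r * 'X^i).

Lemma torus_evalM p r : torus_eval p * torus_eval r = torus_eval (torus_mul p r).
Proof.
rewrite (torus_evalE_outer (leqnn _)) mulr_suml /torus_mul.
rewrite (big_morph _ torus_evalD torus_eval0).
apply: eq_bigr => i _; rewrite torus_evalZ torus_evalMXn -mulrA; congr (_ * _).
rewrite !(torus_evalE_outer (n := size r)) ?size_poly //.
rewrite mulr_sumr mulr_suml; apply: eq_bigr => j _.
rewrite mulrA (torus_eval_twist _ (x2_expr_x1 i)) coef_map /= -!mulrA.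
by rewrite -!exprD addnC.
Qed.

(** The top coefficient is the leading coefficient of [p] times a rescaling of that of [r], and
    substituting a nonzero multiple of the variable is injective. *)
Lemma torus_mul_neq0 (p r : {poly {poly L}}) :
  p != 0 -> r != 0 -> torus_mul p r != 0.
Proof.
move=> p0 r0; apply/eqP=> /(congr1 (coefp ((size p).-1 + (size r).-1))) /=.
rewrite /torus_mul; have := lead_coefE p.
have : lead_coef p != 0 by rewrite lead_coef_eq0.
case: (size p) (size_poly_gt0 p) => [|m]; first by rewrite p0.
move=> _ lp0 lpE; rewrite big_ord_recr /= coefD coefZ coefMXn ltnNge leq_addr /=.
rewrite addKn coef_map /= coef_sum big1 => [|i _]; last first.
  rewrite coefZ coefMXn coef_map_id0 ?comp_poly0 // [r`_ _]nth_default.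
    by rewrite comp_poly0 if_same mulr0.
  have := ltn_ord i; have := size_poly_gt0 r; rewrite r0.
  by case: (size r) => [//|s] _ lt_im; rewrite /= ltn_subRL ltn_add2r.
rewrite add0r coef0 -lpE => /eqP; rewrite mulf_eq0 (negPf lp0) /=.
rewrite comp_poly_eq0 -?lead_coefE ?lead_coef_eq0 ?(negPf r0) //.
by rewrite size_scale ?size_polyX // invr_eq0 expf_neq0.
Qed.

(* Kronecker substitution: X1 shifts the index a mod N^2 by 1, and X2 shifts it by N
   with the phase q^a, so X1^i X2^j sends index 0 to index i + j N. *)
Lemma torus_representation N : (0 < N)%N -> (l %| N)%N ->
  exists m (X1 X2 : 'M[L]_m.+1) (f : {lrmorphism T -> 'M[L]_m.+1}),
    [/\ m.+1 = (N * N)%N, f x1 = X1, f x2 = X2 &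
      forall i j (b : 'I_m.+1), (i < N)%N -> (j < N)%N ->
        (X1 ^+ i * X2 ^+ j) ord0 b = q ^+ (i * j) * (b == i + j * N :> nat)%N%:R].
Proof.
move=> N0 l_N; have [m mE] : exists m, m.+1 = (N * N)%N.
  by exists (N * N).-1; rewrite prednK // muln_gt0 N0.
(* Hence the phase [q ^+ a] is well defined on indices modulo N^2. *)
have qN : q ^+ N = 1.
  by have /dvdnP[n ->] := l_N; rewrite mulnC exprM (prim_expr_order q_prim) expr1n.
have qM : q ^+ m.+1 = 1 by rewrite mE exprM qN expr1n.
pose sh n (a : 'I_m.+1) : 'I_m.+1 := inZp (a + n)%N.
have shE n a : sh n a = ((a + n) %% m.+1)%N :> nat by [].
have q_sh n a : q ^+ sh n a = q ^+ a * q ^+ n by rewrite shE expr_mod // exprD.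
have sh_sh n n' a : sh n (sh n' a) = sh (n' + n)%N a.
  by apply/val_inj; rewrite /= modnDml addnA.
have sh_inj n : injective (sh n).
  apply: (can_inj (g := sh (m.+1 - n %% m.+1)%N)) => a; rewrite sh_sh.
  apply/val_inj => /=; rewrite -modnDmr -(modnDml n) subnKC ?modnn ?addn0.
    by rewrite modn_small.
  by rewrite ltnW // ltn_mod.
pose X1 := monomial_mx (sh 1%N) (fun=> 1 : L).
pose X2 := monomial_mx (sh N) (fun a => q ^+ a).
have X1X i : X1 ^+ i = monomial_mx (sh i) (fun=> 1).
  elim: i => [|i IHi].
    apply/matrixP=> a b; rewrite !mxE mul1r eq_sym; congr (_ == _)%:R.
    by apply/val_inj; rewrite /= addn0 modn_small.
  rewrite exprSr IHi mul_monomial_mx; apply: eq_monomial_mx => a /=.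
    by rewrite sh_sh addn1.
  by rewrite mul1r.
have X2X j : X2 ^+ j = monomial_mx (sh (j * N)%N) (fun a => q ^+ (a * j)).
  elim: j => [|j IHj].
    apply/matrixP=> a b; rewrite !mxE muln0 mul1r eq_sym; congr (_ == _)%:R.
    by apply/val_inj; rewrite /= addn0 modn_small.
  rewrite exprSr IHj mul_monomial_mx; apply: eq_monomial_mx => a /=.
    by rewrite sh_sh mulSnr.
  by rewrite q_sh [(j * N)%N]mulnC (exprM q N) qN expr1n mulr1 mulnS addnC exprD.
have [X1' [XX1 X1X']] : exists B, X1 * B = 1 /\ B * X1 = 1.
  by apply: monomial_mx_unit => // a; rewrite oner_neq0.
have [X2' [XX2 X2X']] : exists B, X2 * B = 1 /\ B * X2 = 1.
  by apply: monomial_mx_unit => // a; rewrite expf_neq0.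
have [_ univ] := torus; have [|f [fx1 fx2 _]] := univ _ X1 X1' X2 X2'.
  split=> //; rewrite !mul_monomial_mx; apply/matrixP=> a b; rewrite !mxE /=.
  by rewrite !sh_sh q_sh mul1r mulr1 mulrA addnC expr1 (mulrC q).
exists m, X1, X2, f; split=> // i j b lt_i lt_j.
have lt_NN a c : (a < N)%N -> (c < N)%N -> (a + c * N < m.+1)%N.
  by move=> lt_a lt_c; rewrite mE; nia.
rewrite X1X X2X mul_monomial_mx mxE /= mul1r sh_sh.
have lt_im : (i < m.+1)%N by have := lt_NN i 0%N lt_i N0; rewrite addn0.
congr (q ^+ (_ * _) * _); first by rewrite add0n modn_small.
by rewrite -val_eqE /= add0n modn_small ?lt_NN.
Qed.

(** For N a multiple of [l] above all degrees, distinct monomials hit distinct columns in row 0 of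
    the representation, so the entry in column i + j N is the coefficient of x1^i x2^j up to a power
    of [q]. *)
Lemma torus_eval_eq0 p : torus_eval p = 0 -> p = 0.
Proof.
move=> ev0; have [n [size_p size_pj]] := size_bound p.
have l0 := prim_order_gt0 q_prim; pose N := (l * n.+1)%N.
have le_nN : (n <= N)%N by rewrite /N; nia.
have [||m [X1 [X2 [f [mE fx1 fx2 fE]]]]] := @torus_representation N.
- by rewrite muln_gt0 l0.
- exact: dvdn_mulr.
apply/polyP=> j; apply/polyP=> i; rewrite coef0 coef0.
have [le_jp|lt_jp] := leqP (size p) j; first by rewrite [p`_j]nth_default ?coef0.
have [le_ip|lt_ip] := leqP (size (p`_j)%R) i; first by rewrite nth_default.
have lt_jN : (j < N)%N := leq_trans lt_jp (leq_trans size_p le_nN).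
have lt_iN : (i < N)%N := leq_trans lt_ip (leq_trans (size_pj j) le_nN).
have lt_m : (i + j * N < m.+1)%N by rewrite mE; nia.
have size_pN := leq_trans size_p le_nN.
have size_pjN k := leq_trans (size_pj k) le_nN.
have := congr1 (fun t => f t ord0 (Ordinal lt_m)) ev0.
rewrite (torus_evalE size_pN size_pjN) rmorph0 mxE raddf_sum summxE.
rewrite (bigD1 (Ordinal lt_jN)) //= [X in _ + X]big1 => [|j' ne_j'].
  rewrite addr0 raddf_sum summxE (bigD1 (Ordinal lt_iN)) //= [X in _ + X]big1 => [|i' ne_i'].
    rewrite linearZ /= rmorphM !rmorphXn /= fx1 fx2 addr0 mxE fE //= eqxx mulr1.
    by move/eqP; rewrite mulf_eq0 expf_eq0 (negPf q0) andbF orbF => /eqP.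
  rewrite linearZ /= rmorphM !rmorphXn /= fx1 fx2 mxE fE //=.
  case: eqP => [/addIn e|]; last by rewrite !mulr0.
  by case/eqP: ne_i'; apply/val_inj.
rewrite raddf_sum summxE big1 // => i' _.
rewrite /= linearZ /= rmorphM !rmorphXn /= fx1 fx2 mxE fE //=.
case: eqP => [e|]; last by rewrite !mulr0.
case/eqP: ne_j'; apply/val_inj => /=.
have := congr1 (divn^~ N) e.
by rewrite /= !divnDMl ?divn_small ?add0n // muln_gt0 l0.
Qed.

Lemma torus_eval_ind (Q : T -> Prop) :
  Q 0 -> Q 1 -> (forall a s t, Q s -> Q t -> Q (a *: s + t)) ->
  (forall s t, Q s -> Q t -> Q (s * t)) -> Q x1 -> Q x2 ->
  forall p, Q (torus_eval p).
Proof.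
move=> Q0 Q1 QZ QM Qx1 Qx2 p; have [n [size_p size_pj]] := size_bound p.
have QX x i : Q x -> Q (x ^+ i).
  by move=> Qx; elim: i => [|i IHi] //; rewrite exprS; apply: QM.
have QD s t : Q s -> Q t -> Q (s + t).
  by move=> Qs Qt; rewrite -[s]scale1r; apply: QZ.
rewrite (torus_evalE size_p size_pj).
elim/big_ind: _ => // j _; elim/big_ind: _ => // i _.
by rewrite -[_ *: _]addr0; apply: QZ => //; apply: QM; apply: QX.
Qed.

(** Inverting this one element inverts both generators: [x1^-1 * u = x2] and
    [x2^-1 * u = q *: x1]. *)
Let u := x1 * x2.

(** An Ore condition: [x1 * u = q *: (u * x1)] and [x2 * u = q^-1 *: (u * x2)], so polynomials can
    be moved across [u]. *)
Lemma torus_eval_commute n p :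
  exists p', torus_eval p * u ^+ n = u ^+ n * torus_eval p'.
Proof.
have evZ a p1 p2 : a *: torus_eval p1 + torus_eval p2 =
    torus_eval (a%:P *: p1 + p2).
  by rewrite torus_evalD torus_evalZ horner_algC mulr_algl.
have step : forall p, exists p', torus_eval p * u = u * torus_eval p'.
  apply: (torus_eval_ind (Q := fun s => exists p', s * u = u * torus_eval p')).
  - by exists 0; rewrite torus_eval0 mul0r mulr0.
  - by exists 1; rewrite torus_eval1 mul1r mulr1.
  - move=> a s t [ps es] [pt et]; exists (a%:P *: ps + pt).
    by rewrite -evZ mulrDl mulrDr -scalerAl -scalerAr es et.
  - move=> s t [ps es] [pt et]; exists (torus_mul ps pt).
    by rewrite -torus_evalM -mulrA et mulrA es mulrA.
  - exists (q%:P *: 'X%:P + 0); rewrite -evZ torus_eval0 addr0 torus_eval_x1 -scalerAr.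
    by rewrite /u [in LHS]x12 -scalerAr mulrA.
  - exists (q^-1%:P *: 'X + 0); rewrite -evZ torus_eval0 addr0 torus_eval_x2 -scalerAr.
    by rewrite /u mulrA x21 -scalerAl.
elim: n p => [|n IHn] p; first by exists p; rewrite mulr1 mul1r.
have [p' e'] := IHn p; have [p'' e''] := step p'.
by exists p''; rewrite exprSr mulrA e' -mulrA e'' mulrA.
Qed.

Lemma torus_gen_unit : (x1 \is a GRing.unit) && (x2 \is a GRing.unit).
Proof.
case: torus => [[x1V x1V' x2V x2V' _] _].
by apply/andP; split; apply/unitrP; [exists x1^-1 | exists x2^-1].
Qed.

(** Sums are brought to a common power of [u]; in products the inner denominator is moved across by
    [torus_eval_commute]. *)
Lemma torus_fraction t : exists n p, t * u ^+ n = torus_eval p.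
Proof.
have evU n : exists p, torus_eval p = u ^+ n.
  elim: n => [|n [p IHp]]; first by exists 1; apply: torus_eval1.
  exists (torus_mul (torus_mul 'X%:P 'X) p).
  by rewrite -!torus_evalM torus_eval_x1 torus_eval_x2 IHp exprS.
have [x1U x2U] := andP torus_gen_unit.
move: t; apply: (quantum_torus_ind torus).
- by exists 0%N, 1; rewrite mulr1 torus_eval1.
- move=> a s t [n [p es]] [m [r et]].
  have [pm em] := evU m; have [pn en] := evU n.
  exists (n + m)%N, (a%:P *: torus_mul p pm + torus_mul r pn).
  rewrite torus_evalD torus_evalZ horner_algC mulr_algl -!torus_evalM -es -et.
  by rewrite em en -!mulrA -!exprD mulrDl -scalerAl (addnC m).
- move=> s t [n [p es]] [m [r et]]; have [r' er'] := torus_eval_commute n r.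
  exists (m + n)%N, (torus_mul p r'); rewrite -torus_evalM -es -[RHS]mulrA -er' -et.
  by rewrite exprD !mulrA.
- by exists 0%N, 'X%:P; rewrite mulr1 torus_eval_x1.
- by exists 1%N, 'X; rewrite expr1 mulKr // torus_eval_x2.
- by exists 0%N, 'X; rewrite mulr1 torus_eval_x2.
- exists 1%N, (q%:P * 'X)%:P; rewrite expr1 /u x12 -scalerAr mulKr //.
  by rewrite torus_evalC rmorphM /= horner_algC horner_algX mulr_algl.
Qed.

(** Clearing denominators turns [s * t = 0] into a vanishing product of skew polynomials, whose
    evaluation is injective and whose leading coefficients multiply. *)
Lemma quantum_torus_domain (s t : T) : s * t = 0 -> s = 0 \/ t = 0.
Proof.
have [x1U x2U] := andP torus_gen_unit.
have uU n : u ^+ n \is a GRing.unit by rewrite unitrX // unitrMl.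
have reg n z : z * u ^+ n = 0 -> z = 0.
  by move=> zu; rewrite -(mulrK (uU n) z) zu mul0r.
have [n [p es]] := torus_fraction s; have [m [r et]] := torus_fraction t.
have [r' er'] := torus_eval_commute n r; move=> st0.
have /torus_eval_eq0 : torus_eval (torus_mul p r') = 0.
  by rewrite -torus_evalM -es -mulrA -er' -et !mulrA st0 !mul0r.
have [p0|p0] := eqVneq p 0.
  by left; apply: (reg n); rewrite es p0 torus_eval0.
have [r'0 _|r'0] := eqVneq r' 0.
  by right; apply: (reg m); apply: (reg n); rewrite et er' r'0 torus_eval0 mulr0.
by move/eqP; rewrite (negPf (torus_mul_neq0 p0 r'0)).
Qed.

Lemma quantum_torus_central t :
  t * x1 = x1 * t -> t * x2 = x2 * t -> t \in @ring_central T.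
Proof.
move=> tx1 tx2; apply/asboolP; apply: (quantum_torus_ind torus) => //.
- by rewrite mulr1 mul1r.
- by move=> a r s er es; rewrite mulrDr mulrDl -scalerAr -scalerAl er es.
- by move=> r s er es; rewrite mulrA er -mulrA es mulrA.
- exact/commrV.
- exact/commrV.
Qed.
End QuantumTorusDomain.

(** * Extension of scalars to the fraction field of the center *)

Section ScalarExtension.
Variables (A : nzRingType) (K : fieldType) (chi : {rmorphism ring_center A -> K}).
Variables (P : algType K) (t : A -> K -> P).
Hypotheses (fracK : is_fraction_field chi)
  (extP : is_scalar_extension (fun z : ring_center A => \val z) chi t).
(** A finite dual basis: [A] is a finitely generated projective module over its center, and the
    coordinates [phi] control the tensor product. *)
Variables (I : finType) (e : I -> A) (phi : I -> A -> ring_center A).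
Hypotheses (phiD : forall k a b, phi k (a + b) = phi k a + phi k b)
  (phiZ : forall k a z, phi k (a * \val z) = phi k a * z)
  (dual_basis : forall a, a = \sum_k e k * \val (phi k a)).

Let chi_eq0 z : (chi z == 0) = (z == 0).
Proof. by rewrite -(inj_eq fracK.1) rmorph0. Qed.

Let tZ a c c' : c *: t a c' = t a (c * c').
Proof. by case: extP. Qed.

Let tM a a' c c' : t a c * t a' c' = t (a * a') (c * c').
Proof. by case: extP. Qed.

Let tDl a a' c : t (a + a') c = t a c + t a' c.
Proof. by case: extP => [[]]. Qed.

Let t_center a z c : t (a * \val z) c = t a (chi z * c).
Proof. by case: extP => [[_ _ h] _ _ _ _]; apply: h. Qed.

Let t11 : t 1 1 = 1.
Proof. by case: extP. Qed.

Let tE a c : t a c = c *: t a 1.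
Proof. by rewrite tZ mulr1. Qed.

Let t0 c : t 0 c = 0.
Proof. by apply: (addrI (t 0 c)); rewrite -tDl !addr0. Qed.

Let tN a c : t (- a) c = - t a c.
Proof. by apply: (addrI (t a c)); rewrite -tDl !subrr t0. Qed.

(** The coordinates [phi k] extend K-linearly to [P] by the universal property, and so does the dual
    basis identity. *)
Lemma scalar_extension_coord :
  exists f : I -> {additive P -> K},
    (forall k a c, f k (t a c) = chi (phi k a) * c) /\
    forall x, x = \sum_k t (e k) (f k x).
Proof.
case: extP => [balt univ _ _ _].
have /choice[f fE] : forall k, exists f : {additive P -> K},
    forall a c, f (t a c) = chi (phi k a) * c.
  move=> k; have [|f [fE _]] := univ K (fun a c => chi (phi k a) * c).
    split=> [a a' c|a c c'|a z c]; first by rewrite phiD rmorphD mulrDl.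
      by rewrite mulrDr.
    by rewrite phiZ rmorphM mulrA.
  by exists f.
(* h fixes all pure tensors, so it is the identity. *)
exists f; split=> // x; pose h x := \sum_k t (e k) (f k x).
have hB : zmod_morphism h.
  move=> y z; rewrite /h -sumrB; apply: eq_bigr => k _.
  by rewrite raddfB !(tE _ (f k _)) (tE _ (_ - _)) scalerBl.
pose h' : {additive P -> P} := HB.pack h (GRing.isZmodMorphism.Build P P h hB).
have [g [_ g_uniq]] := univ P t balt.
have -> : \sum_k t (e k) (f k x) = g x.
  apply: (g_uniq h') => a c; rewrite /= /h {2}(dual_basis a).
  rewrite (big_morph (fun b => t b c) (fun a b => tDl a b c) (t0 c)).
  by apply: eq_bigr => k _; rewrite t_center fE.
exact: (g_uniq (idfun : {additive P -> P})).
Qed.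

Lemma scalar_extension_inj a : t a 1 = 0 -> a = 0.
Proof.
have [f [fE _]] := scalar_extension_coord => ta0.
rewrite (dual_basis a) big1 // => k _.
have : chi (phi k a) == 0 by rewrite -[chi _]mulr1 -fE ta0 raddf0.
by rewrite chi_eq0 => /eqP->; rewrite raddf0 mulr0.
Qed.

Lemma scalar_extension_finite : finite_dimensional P.
Proof.
have [f [_ xE]] := scalar_extension_coord.
exists #|I|, (fun k => t (e (enum_val k)) 1) => x.
exists (fun k => f (enum_val k) x); rewrite {1}[x]xE.
rewrite (reindex (@enum_val _ I)) /=; last exact/onW_bij/enum_val_bij.
by apply: eq_bigr => k _; rewrite tE.
Qed.

(** The finitely many coordinates of [x] are brought to the common denominator [d]; the numerators
    [v k] then assemble into one element of [A]. *)
Lemma scalar_extension_fraction x :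
  exists (c : K) (a : A), c != 0 /\ x = c *: t a 1.
Proof.
have [f [_ xE]] := scalar_extension_coord.
have /choice[r rE] k : exists r : ring_center A * ring_center A,
    r.2 != 0 /\ f k x = chi r.1 / chi r.2.
  by have [a [b [b0 fkE]]] := fracK.2 (f k x); exists (a, b).
pose d := \prod_k (r k).2; pose v k := (r k).1 * \prod_(j | j != k) (r j).2.
have d0 : chi d != 0.
  by rewrite rmorph_prod; apply/prodf_neq0 => k _; rewrite chi_eq0; case: (rE k).
have fkE k : f k x = (chi d)^-1 * chi (v k).
  have [r0 ->] := rE k; move: d0; rewrite /d /v (bigD1 k) //= !rmorphM.
  rewrite mulf_eq0 negb_or => /andP[_ d2].
  by rewrite invfM -mulrA (mulrCA _ (chi _)) mulVf // mulr1 mulrC.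
exists (chi d)^-1, (\sum_k e k * \val (v k)); split; first by rewrite invr_eq0.
rewrite (big_morph (fun b => t b 1) (fun a b => tDl a b 1) (t0 1)) scaler_sumr.
by rewrite {1}[x]xE; apply: eq_bigr => k _; rewrite t_center mulr1 fkE tZ.
Qed.

Lemma scalar_extension_commute a b :
  t a 1 * t b 1 = t b 1 * t a 1 -> a * b = b * a.
Proof.
rewrite !tM mulr1 => ab; apply/eqP; rewrite -subr_eq0; apply/eqP.
by apply: scalar_extension_inj; rewrite tDl tN ab subrr.
Qed.

(** Up to a nonzero scalar an element comes from [A], and centrality descends to [A] because [A]
    embeds in [P]. *)
Lemma scalar_extension_center : has_center P.
Proof.
move=> x; split=> [/asboolP xC|[c ->]]; last first.
  by apply/asboolP=> y; rewrite mulr_algl mulr_algr.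
have [c [a [c0 xE]]] := scalar_extension_fraction x.
have aC : a \in @ring_central A.
  apply/asboolP=> b; apply: scalar_extension_commute.
  by apply: (scalerI c0); rewrite scalerAl scalerAr -xE xC.
exists (c * chi (RingCenter aC)).
rewrite xE -scalerA; congr (_ *: _).
by have := t_center 1 (RingCenter aC) 1; rewrite mul1r -tZ t11.
Qed.

Lemma scalar_extension_skew_field :
  (forall a b : A, a * b = 0 -> a = 0 \/ b = 0) -> is_skew_field P.
Proof.
move=> domA; apply: skew_field_of_domain scalar_extension_finite _ => x y.
have [c [a [c0 ->]]] := scalar_extension_fraction x.
have [d [b [d0 ->]]] := scalar_extension_fraction y.
rewrite -scalerAl -scalerAr scalerA tM mulr1 => /eqP.
rewrite scaler_eq0 mulf_eq0 (negPf c0) (negPf d0) /= => /eqP.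
by case/scalar_extension_inj/domA=> ->; rewrite t0 scaler0; [left | right].
Qed.
End ScalarExtension.

(** * Pairs of units that commute up to a root of unity *)

Lemma sum_primitive_root (L : fieldType) (l : nat) (w : L) m :
  l.-primitive_root w -> (0 < m < l)%N -> \sum_(j < l) w ^+ (j * m) = 0.
Proof.
move=> w_prim /andP[m0 lt_ml]; have wm1 : w ^+ m - 1 != 0.
  by rewrite subr_eq0 -(prim_order_dvd w_prim) gtnNdvd.
apply: (mulfI wm1); rewrite mulr0.
under eq_bigr do rewrite mulnC exprM.
by rewrite -subrX1 -exprM mulnC exprM (prim_expr_order w_prim) expr1n subrr.
Qed.

Lemma primitive_rootV (L : fieldType) l (w : L) :
  l.-primitive_root w^-1 = l.-primitive_root w.
Proof.
congr (_ && _); apply: eq_forallb => i.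
by rewrite !unity_rootE exprVn invr_eq1.
Qed.

Section QuantumPair.
Variables (L : fieldType) (T : unitAlgType L) (l : nat).

Lemma skew_commute_expr (a b : T) (lam : L) i j :
  a * b = lam *: (b * a) -> a ^+ i * b ^+ j = lam ^+ (i * j) *: (b ^+ j * a ^+ i).
Proof.
move=> ab; have ab' k : a * b ^+ k = lam ^+ k *: (b ^+ k * a).
  elim: k => [|k IHk]; first by rewrite mul1r mulr1 scale1r.
  rewrite [b ^+ k.+1]exprSr mulrA IHk -scalerAl -[b ^+ k * a * b]mulrA ab.
  by rewrite -scalerAr scalerA mulrA exprSr.
elim: i => [|i IHi]; first by rewrite mul1r mulr1 scale1r.
rewrite exprSr -[a ^+ i * a * _]mulrA ab' -scalerAr (mulrA (a ^+ i)) IHi -scalerAl scalerA.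
by rewrite mulrA mulSn exprD.
Qed.

Lemma skew_commute_inv (a b : T) (lam : L) : a \is a GRing.unit ->
  a * b = lam *: (b * a) -> b * a^-1 = lam *: (a^-1 * b).
Proof.
move=> aU ab; apply: (mulrI aU); rewrite mulrA ab -scalerAl mulrK //.
by rewrite -scalerAr mulVKr.
Qed.

Definition conj_sum (s t : T) : T := \sum_(m < l) s ^+ m * t * s ^- m.

Lemma conj_sumD s t t' : conj_sum s (t + t') = conj_sum s t + conj_sum s t'.
Proof.
by rewrite -big_split; apply: eq_bigr => m _; rewrite mulrDr mulrDl.
Qed.

Lemma conj_sumMr s t c : c * s = s * c -> s \is a GRing.unit ->
  conj_sum s (t * c) = conj_sum s t * c.
Proof.
move=> cs sU; rewrite mulr_suml; apply: eq_bigr => m _.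
rewrite -!mulrA; congr (_ * (_ * _)).
by apply: commrV; apply: commrX.
Qed.

(** Conjugation by [s] permutes the summands cyclically, the wrap-around being the hypothesis on
    [s ^+ l]. *)
Lemma conj_sum_commute s t : s \is a GRing.unit -> (0 < l)%N ->
  s ^+ l * t = t * s ^+ l -> s * conj_sum s t = conj_sum s t * s.
Proof.
rewrite /conj_sum => sU; case: l => // n _ st.
rewrite mulr_sumr mulr_suml big_ord_recr [RHS]big_ord_recl /= addrC.
congr (_ + _).
  by rewrite expr0 invr1 mul1r mulr1 !mulrA -exprS st exprS mulrA mulrK ?unitrX.
apply: eq_bigr => i _; rewrite !mulrA -exprS [s ^- (bump _ _)]/= /bump leq0n add1n.
by rewrite [in RHS]exprS invrM ?unitrX // mulrA mulrVK // -exprS.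
Qed.

(* Fourier inversion for the action of s by conjugation, of which the powers of b
   are eigenvectors. *)
Lemma conj_sum_inversion s b t lam : s \is a GRing.unit -> b \is a GRing.unit ->
  l.-primitive_root lam -> s * b = lam *: (b * s) ->
  \sum_(j < l) conj_sum s (t * b ^+ j) * b ^- j = l%:R *: t.
Proof.
move=> sU bU lam_prim sb; have := prim_order_gt0 lam_prim => l0.
transitivity (\sum_(m < l) (\sum_(j < l) lam ^+ (j * m)) *: (s ^+ m * t * s ^- m)).
  under [RHS]eq_bigr do rewrite scaler_suml.
  rewrite [RHS]exchange_big; apply: eq_bigr => j _; rewrite mulr_suml.
  apply: eq_bigr => m _; have := skew_commute_expr j m (skew_commute_inv sU sb).
  rewrite exprVn => /(congr1 (fun x => s ^+ m * t * (x * b ^- j))).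
  rewrite -scalerAl mulrK ?unitrX // -scalerAr => <-.
  by rewrite !mulrA.
rewrite (bigD1 (Ordinal l0)) //= [X in _ + X]big1 ?addr0 => [|m m0].
  rewrite expr0 invr1 mul1r mulr1; congr (_ *: _).
  under eq_bigr do rewrite muln0 expr0.
  by rewrite sumr_const card_ord.
rewrite (sum_primitive_root lam_prim) ?scale0r // ltn_ord andbT lt0n.
by apply: contra m0 => /eqP m0; apply/eqP/val_inj.
Qed.

Variables (y z : T) (w : L).
Hypotheses (yU : y \is a GRing.unit) (zU : z \is a GRing.unit).
Hypotheses (w_prim : l.-primitive_root w) (yz : y * z = w *: (z * y)).
Hypothesis pair_central :
  forall t, t * y = y * t -> t * z = z * t -> t \in @ring_central T.

Let l0 : (0 < l)%N := prim_order_gt0 w_prim.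

Lemma quantum_pair_expr_central :
  y ^+ l \in @ring_central T /\ z ^+ l \in @ring_central T.
Proof.
have wl := prim_expr_order w_prim.
split; apply: pair_central; rewrite -?exprS -?exprSr //.
  by have := skew_commute_expr l 1 yz; rewrite muln1 wl scale1r expr1.
by have := skew_commute_expr 1 l yz; rewrite mul1n wl scale1r expr1.
Qed.

Let yl t : y ^+ l * t = t * y ^+ l.
Proof. by have [/asboolP] := quantum_pair_expr_central. Qed.

Let zl t : z ^+ l * t = t * z ^+ l.
Proof. by have [_ /asboolP] := quantum_pair_expr_central. Qed.

(** Conjugation by [y ^+ m] only rescales [z], so it preserves the centralizer of [z]. *)
Lemma conj_commute m t : t * z = z * t ->
  y ^+ m * t * y ^- m * z = z * (y ^+ m * t * y ^- m).
Proof.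
move=> tz; have yzm : y ^+ m * z = w ^+ m *: (z * y ^+ m).
  by have := skew_commute_expr m 1 yz; rewrite muln1 !expr1.
have zym := skew_commute_inv (unitrX m yU) yzm.
have wm0 : w ^+ m != 0.
  by rewrite expf_neq0 // (primitive_root_neq0 w_prim).
apply: (scalerI wm0); rewrite -mulrA scalerAr -zym !mulrA -(mulrA _ t z) tz !mulrA.
by rewrite yzm -!scalerAl.
Qed.

(** A trace in two stages: the inner sum lands in C(z), the outer one takes C(z) to the center. *)
Definition pair_trace (t : T) : T := conj_sum y (conj_sum z t).

Lemma conj_sum_central t : t * z = z * t -> conj_sum y t \in @ring_central T.
Proof.
move=> tz; apply: pair_central.
  by rewrite conj_sum_commute.
by rewrite mulr_suml mulr_sumr; apply: eq_bigr => m _; exact: conj_commute.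
Qed.

Lemma pair_trace_central t : pair_trace t \in @ring_central T.
Proof. by apply: conj_sum_central; rewrite conj_sum_commute. Qed.

(** Fourier inversion is applied twice: to conjugation by [z] with eigenvectors [y ^+ i], then to
    conjugation by [y] with eigenvectors [z ^+ j]. *)
Lemma pair_trace_inversion t :
  \sum_(i < l) \sum_(j < l) pair_trace (t * y ^+ i * z ^+ j) * (z ^- j * y ^- i)
    = (l ^ 2)%N%:R *: t.
Proof.
have wV_prim : l.-primitive_root w^-1 by rewrite primitive_rootV.
have w0 : w != 0 by rewrite -invr_eq0 (primitive_root_neq0 wV_prim).
have zy : z * y = w^-1 *: (y * z) by rewrite yz scalerA mulVf // scale1r.
rewrite -mulnn natrM -scalerA -(conj_sum_inversion t zU yU wV_prim zy) scaler_sumr.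
apply: eq_bigr => i _.
rewrite scalerAl -(conj_sum_inversion _ yU zU w_prim yz) mulr_suml.
apply: eq_bigr => j _; rewrite mulrA /pair_trace conj_sumMr //.
by rewrite -exprSr exprS.
Qed.

(** By Fourier inversion an element of C(z) is a combination of powers of [z^-1] with central
    coefficients; dividing by [l] is allowed since L has a primitive l-th root of unity. *)
Lemma pair_centralizer_commute t s : t * z = z * t -> s * z = z * s -> t * s = s * t.
Proof.
move=> tz sz; have := conj_sum_inversion t yU zU w_prim yz.
have lL := prim_root_natf_neq0 w_prim.
move/(canLR (scalerK lL)) => <-; rewrite -scalerAl -scalerAr; congr (_ *: _).
rewrite mulr_suml mulr_sumr; apply: eq_bigr => j _.
have /asboolP c : conj_sum y (t * z ^+ j) \in @ring_central T.
  by apply: conj_sum_central; rewrite -mulrA -exprSr exprS mulrA tz mulrA.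
rewrite [RHS]mulrA -(c s) -!mulrA; congr (_ * _).
by symmetry; apply: commrV; apply: commrX.
Qed.

Lemma quantum_pair_commute_add_inv t :
  (forall r s : T, r * s = 0 -> r = 0 \/ s = 0) -> odd l ->
  t * (z + z^-1) = (z + z^-1) * t -> t * z = z * t.
Proof.
move=> domT odd_l; rewrite mulrDl mulrDr => tz.
(* The commutator d = [z, t] satisfies z d z = d, hence z^(2l) d = d; and if z^(2l) = 1
   then z^2 is a scalar, which forces w^2 = 1. *)
pose d := z * t - t * z; have dE : z * d * z = d.
  have -> : d = t * z^-1 - z^-1 * t.
    by apply/eqP; rewrite subr_eq addrAC eq_sym subr_eq addrC tz addrC.
  rewrite mulrBr mulrBl mulrA mulrVK // mulVKr //.
  by apply/eqP; rewrite subr_eq addrAC eq_sym subr_eq addrC tz addrC.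
have dX n : z ^+ n * d * z ^+ n = d.
  elim: n => [|n IHn]; first by rewrite mul1r mulr1.
  by rewrite -[RHS]IHn -[in RHS]dE {1}exprSr exprS !mulrA.
have zd : (z ^+ 2 ^+ l - 1) * d = 0.
  rewrite mulrBl mul1r -{2}(dX l) -[X in _ - X]mulrA -zl mulrA exprAC.
  by rewrite expr2 subrr.
case/domT: zd => [|/eqP]; last by rewrite subr_eq0 => /eqP.
have -> : z ^+ 2 ^+ l - 1 = horner_alg (z ^+ 2) ('X^l - 1).
  by rewrite rmorphB rmorph1 rmorphXn /= horner_algX.
(* X^l - 1 is the product of the X - w^i, so in a domain some factor z^2 - w^i vanishes. *)
rewrite -(factor_Xn_sub_1 w_prim) rmorph_prod.
elim: (index_iota 0 l) => [|i r IHr].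
  by rewrite big_nil => /eqP; rewrite oner_eq0.
rewrite big_cons => /domT[|//]; rewrite rmorphB /= horner_algX horner_algC => /eqP.
rewrite subr_eq0 => /eqP z2.
have : w ^+ 2 = 1.
  have := skew_commute_expr 1 2 yz; rewrite z2 expr1 mulr_algl mulr_algr mul1n.
  rewrite scalerA mulrC -scalerA => /(scalerI (expf_neq0 _ (primitive_root_neq0 w_prim))).
  rewrite -{1}[y]scale1r => /eqP; rewrite -subr_eq0 -scalerBl scaler_eq0.
  rewrite subr_eq0 eq_sym => /orP[/eqP //|/eqP y0].
  by move: yU; rewrite y0 unitr0.
move/eqP; rewrite -(prim_order_dvd w_prim) => l2.
(* An odd divisor of 2 is 1; then [w = 1] and [z] itself is central. *)
have l1 : l = 1%N.
  by apply/eqP; rewrite -dvdn1 -(Gauss_dvdr _ (_ : coprime l 2)) // coprimen2.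
have w1 : w = 1 by rewrite -(prim_expr_order w_prim) l1 expr1.
have /asboolP zc : z \in @ring_central T.
  by apply: pair_central => //; rewrite yz w1 scale1r.
by rewrite zc.
Qed.
End QuantumPair.

(** * Invariants of a semilinear involution *)

Section InvariantForm.
Variables (G : finType) (L : fieldType) (T : unitAlgType L).
Variables (act : G -> {rmorphism T -> T}) (S : {rmorphism T -> T}) (s : L -> L).
Variables (l : nat) (alpha zeta : L) (y z w : T).
Hypotheses (invP : forall r, (r \in ring_invariant act) = (S r == r))
  (SS : forall r, S (S r) = r) (SZ : forall c r, S (c *: r) = s c *: S r)
  (s_alpha : s alpha = - alpha) (alpha2 : alpha *+ 2 != 0).
Hypotheses (domT : forall r r' : T, r * r' = 0 -> r = 0 \/ r' = 0)
  (yU : y \is a GRing.unit) (zU : z \is a GRing.unit)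
  (zeta_prim : l.-primitive_root zeta) (yz : y * z = zeta *: (z * y))
  (pair_central : forall r, r * y = y * r -> r * z = z * r ->
    r \in @ring_central T).
Hypotheses (Sy : S y = y) (Sw : S w = w) (wz : w * z = z * w)
  (w_z : forall r, r * w = w * r -> r * z = z * r).

Local Notation A := (invariant_ring act).

Lemma invariant_center (a : A) :
  \val a \in @ring_central T -> a \in @ring_central A.
Proof.
by move=> /asboolP aC; apply/asboolP=> b; apply/val_inj; rewrite !rmorphM /= aC.
Qed.

(** [S] is an involution, hence surjective, so it preserves the center of [T]. *)
Lemma central_trace c : c \in @ring_central T ->
  exists u : ring_center A, \val (\val u) = c + S c.
Proof.
move=> /asboolP cC; have ScC r : S c * r = r * S c.
  by rewrite -[r]SS -!rmorphM cC.
have inv_u : c + S c \in ring_invariant act.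
  by rewrite invP rmorphD SS addrC.
have cen_u : InvariantRing inv_u \in @ring_central A.
  by apply: invariant_center; apply/asboolP=> r; rewrite /= mulrDl mulrDr cC ScC.
by exists (RingCenter cen_u).
Qed.

Let two0 : (2%:R : L) != 0.
Proof. by apply: contra alpha2 => /eqP e2; rewrite -mulr_natr e2 mulr0. Qed.

Let alpha0 : alpha != 0.
Proof. by apply: contra alpha2 => /eqP->; rewrite mul0rn. Qed.

(** The invariants span [T] over L: 2 alpha r = alpha (r + S r) + (alpha r + S (alpha r)). Commuting
    with invariants is therefore enough. *)
Lemma center_invariant (a : A) :
  a \in @ring_central A -> \val a \in @ring_central T.
Proof.
move=> /asboolP aC; apply/asboolP=> r.
have aC' r' : \val a * (r' + S r') = (r' + S r') * \val a.
  have inv_r : r' + S r' \in ring_invariant act by rewrite invP rmorphD SS addrC.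
  by have /(congr1 val) := aC (InvariantRing inv_r); rewrite !rmorphM.
have rE : (alpha *+ 2) *: r
    = alpha *: (r + S r) + (alpha *: r + S (alpha *: r)).
  rewrite SZ s_alpha scaleNr scalerDr addrACA subrr addr0 -scalerDl.
  by rewrite -mulr2n.
apply: (scalerI alpha2); rewrite scalerAr scalerAl rE mulrDr mulrDl aC'.
by rewrite -scalerAr -scalerAl aC'.
Qed.

Lemma invariant_dual_basis :
  exists (I : finType) (e : I -> A) (phi : I -> A -> ring_center A),
    [/\ forall k a b, phi k (a + b) = phi k a + phi k b,
        forall k a u, phi k (a * \val u) = phi k a * u
      & forall a, a = \sum_k e k * \val (phi k a)].
Proof.
(* The coordinates of a are the traces of alpha^b c, for b = 0, 1 and
   c = pair_trace (a y^i z^j); c is recovered from them as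
   (c + S c) / 2 + (alpha c + S (alpha c)) / (2 alpha). *)
pose I : finType := (bool * ('I_l * 'I_l))%type.
pose tr (a : T) (i j : 'I_l) := pair_trace l y z (a * y ^+ i * z ^+ j).
have trC a i j : tr a i j \in @ring_central T.
  exact: (pair_trace_central yU zU zeta_prim yz pair_central).
have /choice[phi phiE] (k : I) : exists phi : A -> ring_center A,
    forall a, \val (\val (phi a)) =
      alpha ^+ k.1 *: tr (\val a) k.2.1 k.2.2
        + S (alpha ^+ k.1 *: tr (\val a) k.2.1 k.2.2).
  have /choice[phi phiE] (a : A) : exists u : ring_center A,
    \val (\val u) = alpha ^+ k.1 *: tr (\val a) k.2.1 k.2.2
        + S (alpha ^+ k.1 *: tr (\val a) k.2.1 k.2.2).
    apply: central_trace; apply/asboolP=> r.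
    by rewrite -scalerAl -scalerAr; have /asboolP-> := trC (\val a) k.2.1 k.2.2.
  by exists phi.
(* The factor 2 alpha^b l^2 inverts the descent formula and the Fourier inversion; the extra 2
   compensates for symmetrizing [h k] into the invariant [h k + S (h k)]. *)
pose h (k : I) : T := (2%:R * (2%:R * alpha ^+ k.1 * (l ^ 2)%N%:R))^-1 *:
  (z ^- k.2.2 * y ^- k.2.1).
have inv_e k : h k + S (h k) \in ring_invariant act by rewrite invP rmorphD SS addrC.
exists I, (fun k => InvariantRing (inv_e k)), phi; split=> [k a b|k a u|a].
- do 2!apply/val_inj; rewrite /= !phiE.
  have -> : tr (\val (a + b)) k.2.1 k.2.2
          = tr (\val a) k.2.1 k.2.2 + tr (\val b) k.2.1 k.2.2.
    by rewrite /tr rmorphD !mulrDl /pair_trace !conj_sumD.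
  by rewrite !scalerDr rmorphD addrACA.
- do 2!apply/val_inj; rewrite /= !phiE.
  have uC : forall r, \val (\val u) * r = r * \val (\val u).
    by move=> r; have /asboolP-> := center_invariant (valP u).
  have -> : tr (\val (a * \val u)) k.2.1 k.2.2
          = tr (\val a) k.2.1 k.2.2 * \val (\val u).
    rewrite /tr rmorphM /= -!mulrA uC !mulrA /pair_trace.
    by rewrite (conj_sumMr _ _ (uC z) zU) (conj_sumMr _ _ (uC y) yU).
  have Su : S (\val (\val u)) = \val (\val u).
    by apply/eqP; rewrite -invP; apply: valP.
  by rewrite scalerAl rmorphM /= Su mulrDl.
- apply/val_inj; rewrite [RHS]rmorph_sum /=.
  have Sphi k : S (\val (\val (phi k a))) = \val (\val (phi k a)).
    by apply/eqP; rewrite -invP; apply: valP.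
  have Sa : S (\val a) = \val a by apply/eqP; rewrite -invP; apply: valP.
  have halfE : \sum_k h k * \val (\val (phi k a)) = 2%:R^-1 *: \val a.
    have lL := prim_root_natf_neq0 zeta_prim.
    have l2L : (l ^ 2)%N%:R != 0 :> L by rewrite natrX expf_neq0.
    rewrite -[\val a](scalerK l2L).
    rewrite -(pair_trace_inversion yU zU zeta_prim yz).
    rewrite pair_bigA /= scalerA scaler_sumr.
    transitivity (\sum_b \sum_p h (b, p) * \val (\val (phi (b, p) a))).
      by rewrite pair_bigA; apply: eq_bigr => [[b p]].
    rewrite big_bool -big_split; apply: eq_bigr => p _ /=.
    rewrite !phiE /h /= !expr1 !expr0 !scale1r mulr1 SZ s_alpha.
    rewrite scaleNr -scalerBr -!scalerAl -scalerAr scalerA.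
    have -> : (2%:R * (2%:R * alpha * (l ^ 2)%N%:R))^-1 * alpha
        = (2%:R * (2%:R * (l ^ 2)%N%:R))^-1.
      by rewrite (mulrAC 2%:R) [2%:R * (_ * alpha)]mulrA (invfM _ alpha) mulfVK.
    rewrite -scalerDr -mulrDr addrACA (addrC (- _)) subrr addr0 -mulr2n.
    rewrite -[tr _ _ _ *+ 2]scaler_nat -scalerAr.
    have /asboolP <- := trC (invariant_ring_val a) p.1 p.2.
    rewrite scalerA; congr (_ *: _).
    by rewrite !invfM mulrC mulVKf // mulrC.
  have xx : 2%:R^-1 *: \val a + 2%:R^-1 *: \val a = \val a.
    by rewrite -scalerDl -mulr2n -[2%:R^-1 *+ 2]mulr_natr mulVf // scale1r.
  have Sx : S (2%:R^-1 *: \val a) = 2%:R^-1 *: \val a.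
    apply: (scalerI two0); rewrite !scaler_nat -raddfMn !mulr2n xx.
    exact: Sa.
  under eq_bigr do rewrite mulrDl -{2}Sphi -rmorphM.
  by rewrite big_split /= -rmorph_sum halfE Sx xx.
Qed.

(** Every element of [P] is a scalar times some [t a 1], so the commutation conditions of the
    criterion reduce to conditions in [T], where C(w) = C(z). *)
Lemma invariant_form_crossed_product (K : fieldType)
    (chi : {rmorphism ring_center A -> K}) (P : algType K) (t : A -> K -> P) :
  is_fraction_field chi ->
  is_scalar_extension (fun u : ring_center A => \val u) chi t ->
  is_cyclic_crossed_product P.
Proof.
move=> fracK extP; have [I [e [phi [phiD phiZ basis]]]] := invariant_dual_basis.
have [_ _ t11 tM tZ] := extP.
have l0 := prim_order_gt0 zeta_prim; have lE : l.-1.+1 = l by rewrite prednK.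
have [ylC _] := quantum_pair_expr_central zeta_prim yz pair_central.
have inv_y : y \in ring_invariant act by rewrite invP Sy.
have inv_y' : y^-1 \in ring_invariant act by rewrite invP rmorphV // Sy.
have inv_w : w \in ring_invariant act by rewrite invP Sw.
pose yA : A := InvariantRing inv_y; pose y'A : A := InvariantRing inv_y'.
pose wA : A := InvariantRing inv_w.
have fracP := scalar_extension_fraction fracK extP phiD phiZ basis.
have comP := scalar_extension_commute fracK extP phiD phiZ basis.
have tcom c d a b : a * b = b * a -> (c *: t a 1) * (d *: t b 1)
     = (d *: t b 1) * (c *: t a 1).
  by move=> ab; rewrite -!scalerAl -!scalerAr !scalerA !tM ab (mulrC c).
have tcom' c a b : c != 0 -> (c *: t a 1) * t b 1 = t b 1 * (c *: t a 1) ->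
    val a * val b = val b * val a.
  move=> c0; rewrite -scalerAl -scalerAr => /(scalerI c0)/comP/(congr1 val).
  by rewrite !rmorphM.
have tX a m : t a 1 ^+ m = t (a ^+ m) 1.
  by elim: m => [|m IHm]; rewrite ?t11 // !exprS IHm tM mulr1.
have valyw : \val (yA * wA * y'A) * z = z * \val (yA * wA * y'A).
  by have := conj_commute yU zeta_prim yz 1 wz; rewrite !expr1.
apply: (@cyclic_crossed_product_criterion K P (t wA 1) (t yA 1) (t y'A 1) l.-1).
- apply: (scalar_extension_skew_field fracK extP phiD phiZ basis) => a b ab.
  have : val a * val b = 0 by rewrite -rmorphM ab rmorph0.
  by case/domT=> v0; [left | right]; apply/val_inj; rewrite v0.
- exact: (scalar_extension_finite extP phiD phiZ basis).
- exact: (scalar_extension_center fracK extP phiD phiZ basis).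
- rewrite tM mulr1 -t11; congr (t _ 1); apply/val_inj; exact: divrr.
- rewrite tM mulr1 -t11; congr (t _ 1); apply/val_inj; exact: mulVr.
- move=> x; have [c [a [_ ->]]] := fracP x.
  rewrite tX -[t (yA ^+ _) 1]scale1r; apply: tcom; apply/val_inj.
  by rewrite !rmorphM rmorphXn /= lE; have /asboolP-> := ylC.
- rewrite !tM !mulr1; apply/asboolP; rewrite !tM; congr (t _ _).
  apply/val_inj; rewrite [LHS]rmorphM [RHS]rmorphM.
  exact: (pair_centralizer_commute yU zU zeta_prim yz pair_central valyw wz).
- move=> x x' /asboolP xw /asboolP x'w.
  have [c [a [c0 xE]]] := fracP x; have [c' [a' [c'0 x'E]]] := fracP x'.
  rewrite xE in xw *; rewrite x'E in x'w *; apply: tcom; apply/val_inj.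
  rewrite !rmorphM /=.
  apply: (pair_centralizer_commute yU zU zeta_prim yz pair_central).
    exact/w_z/(tcom' _ _ _ c0 xw).
  exact/w_z/(tcom' _ _ _ c'0 x'w).
- move=> x /asboolP xw xy; have [c [a [c0 xE]]] := fracP x.
  rewrite xE in xw xy *.
  have /invariant_center/asboolP aC : val a \in @ring_central T.
    apply: pair_central; first exact: tcom' c0 xy.
    exact/w_z/(tcom' _ _ _ c0 xw).
  apply/asboolP=> x'; have [c' [a' [_ ->]]] := fracP x'.
  exact: tcom.
Qed.
End InvariantForm.

(** * The quadratic extension and the three actions *)

(** By the degree, [sigma] is nontrivial, so it moves the generator [alpha] to the other root of X^2
    - D; as this is [- alpha], distinct from [alpha], the characteristic is not 2. *)
Lemma quadratic_galois_conj (k : fieldType) (L : splittingFieldType k)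
    (alpha : L) (D : k) (sigma : gal_of {:L}) :
  <<1; alpha>>%VS = {:L}%VS -> alpha ^+ 2 = D%:A ->
  \dim {:L} = 2%N -> galois 1 {:L} ->
  ('Gal({:L} / 1) = [set 1; sigma])%g ->
  [/\ forall g : gal_of {:L}, g = 1%g \/ g = sigma, (sigma * sigma)%g = 1%g,
      sigma alpha = - alpha & alpha *+ 2 != 0].
Proof.
move=> genL alpha2 dimL galL GalE.
have gE (g : gal_of {:L}) : g = 1%g \/ g = sigma.
  have : g \in 'Gal({:L} / 1)%g by rewrite gal_kHom ?sub1v // k1AHom.
  by rewrite GalE !inE => /orP[] /eqP; [left | right].
have sigma1 : sigma != 1%g.
  apply/eqP=> s1; have := galois_dim galL.
  by rewrite GalE s1 setUid cards1 dimL dimv1.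
have ss : (sigma * sigma)%g = 1%g.
  case: (gE (sigma * sigma)%g) => // /(canRL (mulKg sigma)).
  by rewrite mulVg => /eqP; rewrite (negPf sigma1).
have s_alpha : sigma alpha != alpha.
  apply: contra sigma1 => /eqP s_alpha; apply/gal_eqP=> v _; rewrite gal_id.
  have : (<<1; alpha>> <= fixedField [set sigma])%VS.
    apply/FadjoinP; split; first exact: sub1v.
    by apply/fixedFieldP; rewrite ?memvf // => g /set1P->.
  rewrite genL => /subvP/(_ v (memvf v))/mem_fixedFieldP[_]; apply.
  exact: set11.
have s_alphaN : sigma alpha = - alpha.
  apply/eqP; rewrite -addr_eq0.
  have : (sigma alpha - alpha) * (sigma alpha + alpha) == 0.
    by rewrite -subr_sqr -rmorphXn alpha2 /= linearZ rmorph1 subrr.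
  by rewrite mulf_eq0 subr_eq0 (negPf s_alpha).
split=> //; apply: contra s_alpha; rewrite s_alphaN mulr2n addr_eq0 => /eqP <-.
by [].
Qed.

(* If sigma swaps x1, x2 and inverts q and rt, where rt^2 = q, then it fixes
   y = rt^-1 x1 x2 and inverts z = x1 x2^-1, as in case (2). *)
Section SwappedGenerators.
Variables (L : fieldType) (q rt : L) (l : nat) (T : unitAlgType L) (x1 x2 : T).
Hypotheses (torus : is_quantum_torus q x1 x2) (q_prim : l.-primitive_root q).
Hypotheses (odd_l : odd l) (rt2 : rt ^+ 2 = q).

Let x12 : x1 * x2 = q *: (x2 * x1).
Proof. by case: torus => [[]]. Qed.

Let q0 : q != 0 := primitive_root_neq0 q_prim.

Let rt0 : rt != 0.
Proof. by apply: contra q0 => /eqP r0; rewrite -rt2 r0 expr0n. Qed.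

Let x1U : x1 \is a GRing.unit.
Proof. by have /andP[] := torus_gen_unit torus. Qed.

Let x2U : x2 \is a GRing.unit.
Proof. by have /andP[] := torus_gen_unit torus. Qed.

Local Notation y := (rt^-1 *: (x1 * x2)).
Local Notation z := (x1 * x2^-1).

Let x21V : x2^-1 * x1 = q *: (x1 * x2^-1).
Proof.
apply: (mulrI x2U); rewrite mulVKr // -scalerAr mulrA; apply: (mulIr x2U).
by rewrite -scalerAl mulrVK // x12.
Qed.

Lemma swapped_generators_commute : y * z = q ^- 2 *: (z * y).
Proof.
rewrite -scalerAr -scalerAl scalerA mulrC -scalerA; congr (_ *: _).
rewrite !mulrA -(mulrA x1 x2 x1) -(mulrA x1 x2^-1 x1) x21V.
rewrite -scalerAr -scalerAl scalerA (mulrA x1 x1) mulrVK //.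
have -> : x2 * x1 = q^-1 *: (x1 * x2) by rewrite x12 scalerA mulVf ?scale1r.
rewrite -scalerAr -scalerAl (mulrA x1 x1) mulrK //; congr (_ *: _).
by rewrite expr2 invfM mulfVK.
Qed.

(** Since [z * (x1 * x2) = q *: x1 ^+ 2], [t] commutes with [x1 ^+ 2]. As [x1 ^+ l] is central and
    [l] is odd, [t] commutes with [x1], and then with [x2]. *)
Lemma swapped_generators_central t :
  t * y = y * t -> t * z = z * t -> t \in @ring_central T.
Proof.
rewrite -scalerAr -scalerAl => /(scalerI (invr_neq0 rt0)) tx12 tz.
have tx11 : t * x1 ^+ 2 = x1 ^+ 2 * t.
  have : z * (x1 * x2) = q *: x1 ^+ 2.
    by rewrite !mulrA -(mulrA x1) x21V -scalerAr -scalerAl mulrA mulrVK // expr2.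
  move=> /(canLR (scalerK q0)) <-; rewrite -scalerAr -scalerAl.
  by rewrite (mulrA t) tz -!(mulrA z) tx12.
have x1lC r : x1 ^+ l * r = r * x1 ^+ l.
  have /asboolP-> // : x1 ^+ l \in @ring_central T.
  apply: (quantum_torus_central torus); first by rewrite -exprSr exprS.
  have := skew_commute_expr l 1 x12.
  by rewrite muln1 (prim_expr_order q_prim) scale1r expr1.
have tx1 : t * x1 = x1 * t.
  have x1lU : x1 ^+ l \is a GRing.unit by rewrite unitrX.
  apply: (mulIr x1lU); rewrite -[RHS]mulrA -(x1lC t) (mulrA x1) -[LHS]mulrA -exprS.
  have -> : l.+1 = (2 * (uphalf l))%N.
    by rewrite mul2n -[in LHS](odd_double_half l) uphalf_half odd_l doubleD.
  by rewrite exprM; apply/commrX/tx11.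
apply: (quantum_torus_central torus) => //.
by apply: (mulrI x1U); rewrite mulrA -tx1 -mulrA tx12 !mulrA.
Qed.
End SwappedGenerators.

Theorem proposition3
    (k : fieldType) (L : splittingFieldType k) (alpha : L) (D : k)
    (sigma : gal_of {:L}) (l : nat) (q : L)
    (Lq : unitAlgType L) (x1 x2 : Lq)
    (act : gal_of {:L} -> {rmorphism Lq -> Lq})
    (K : fieldType) (chi : {rmorphism ring_center (invariant_ring act) -> K})
    (P : algType K) (t : invariant_ring act -> K -> P) :
  <<1; alpha>>%VS = {:L}%VS -> alpha ^+ 2 = D%:A ->
  \dim {:L} = 2%N -> galois 1 {:L} ->
  ('Gal({:L} / 1) = [set 1; sigma])%g ->
  odd l -> l.-primitive_root q ->
  is_quantum_torus q x1 x2 ->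
  is_semilinear_action act ->
  [\/ [/\ q \in 1%VS, act sigma x1 = x1 & act sigma x2 = x2],
      [/\ sigma q = q^-1, act sigma x1 = x1 & act sigma x2 = x2^-1]
    | [/\ sigma q = q^-1, act sigma x1 = x2 & act sigma x2 = x1]] ->
  is_fraction_field chi ->
  is_scalar_extension (fun z : ring_center (invariant_ring act) => \val z) chi t ->
  is_cyclic_crossed_product P.
Proof.
move=> genL alpha2 dimL galL GalE odd_l q_prim torus [act1 actM actA] cases.
move=> fracK extP.
have [gE ss s_alpha alpha20] := quadratic_galois_conj genL alpha2 dimL galL GalE.
have invP r : (r \in ring_invariant act) = (act sigma r == r).
  apply/forallP/idP => [/(_ sigma) //|sr g].
  by case: (gE g) => -> //; rewrite act1.
have SS r : act sigma (act sigma r) = r by rewrite -actM ss act1.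
have SZ c r : act sigma (c *: r) = sigma c *: act sigma r.
  by rewrite -mulr_algl rmorphM actA mulr_algl.
have domT := quantum_torus_domain torus q_prim.
have [[_ _ _ _ x12] _] := torus.
have /andP[x1U x2U] := torus_gen_unit torus.
have q0 := primitive_root_neq0 q_prim.
case: cases => [[_ S1 S2]|[_ S1 S2]|[sq S1 S2]].
- apply: (invariant_form_crossed_product invP SS SZ s_alpha alpha20 domT x1U x2U
    q_prim x12 (quantum_torus_central torus) S1 S2 _ _ fracK extP) => //.
- apply: (invariant_form_crossed_product invP SS SZ s_alpha alpha20 domT x1U x2U
    q_prim x12 (quantum_torus_central torus) S1 (w := x2 + x2^-1) _ _ _ fracK extP).
  + by rewrite rmorphD rmorphV // S2 invrK addrC.
  + by rewrite mulrDl mulrDr mulVr ?divrr.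
  + move=> r; apply: (quantum_pair_commute_add_inv x1U x2U q_prim x12) => //.
    exact: (quantum_torus_central torus).
(* For odd [l], q^((l+1)/2) is a square root of [q]; being a power of [q], it is inverted by
   [sigma]. *)
- pose rt := q ^+ uphalf l.
  have rt2 : rt ^+ 2 = q.
    rewrite -exprM muln2.
    have -> : (uphalf l).*2 = l.+1.
      by rewrite -[in RHS](odd_double_half l) uphalf_half odd_l doubleD.
    by rewrite exprS (prim_expr_order q_prim) mulr1.
  have rt0 : rt != 0 by rewrite expf_neq0.
  (* Squaring keeps the root primitive because [l] is odd. *)
  have q2_prim : l.-primitive_root (q ^- 2).
    by rewrite primitive_rootV (prim_root_exp_coprime 2 q_prim) coprime2n.
  have yz := swapped_generators_commute rt torus q_prim.
  have yzC := swapped_generators_central torus q_prim odd_l rt2.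
  have yU : rt^-1 *: (x1 * x2) \is a GRing.unit.
    by rewrite scaler_unit ?unitfE ?invr_eq0 // unitrMl.
  have zU : x1 * x2^-1 \is a GRing.unit by rewrite unitrMl // unitrV.
  have Sy : act sigma (rt^-1 *: (x1 * x2)) = rt^-1 *: (x1 * x2).
    rewrite SZ rmorphM S1 S2 x12 scalerA; congr (_ *: _).
    have s_rt : sigma rt = rt^-1 by rewrite rmorphXn /= sq exprVn.
    by rewrite fmorphV /= s_rt invrK -[X in _ = _ * X]rt2 expr2 mulKf.
  have Sz : act sigma (x1 * x2^-1) = (x1 * x2^-1)^-1.
    by rewrite rmorphM rmorphV // S1 S2 invrM ?unitrV // invrK.
  apply: (invariant_form_crossed_product invP SS SZ s_alpha alpha20 domT yU zU
    q2_prim yz yzC Sy (w := x1 * x2^-1 + (x1 * x2^-1)^-1) _ _ _ fracK extP).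
  + by rewrite rmorphD rmorphV // Sz invrK addrC.
  + by rewrite mulrDl mulrDr mulVr ?divrr.
  + by move=> r; apply: (quantum_pair_commute_add_inv yU zU q2_prim yz).
Qed.
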